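(* With $(y)_n$ denoting the number of permutations in $F_n(321,3124)$ with label $(y)$, for all $n\ge0$ and all $k\ge2$ the following hold. (i) $(1a)_n=F_{n-2}$. (ii) $(1b)_n=F_{n+1}-n-1$. (iii) $(k)_n=F_{n-k-1}$. (iv) $|F_n(321,3124)|=F_{n+2}-n-1$.
   Context: $F_n$ (without arguments) is the Fibonacci number with the following indexing: $F_n=0$ for $n<-2$, $F_{-2}=1$, $F_{-1}=0$, and $F_n=F_{n-1}+F_{n-2}$ for $n\ge0$ (so $F_0=F_1=1$). A Fishburn permutation is a permutation $\pi$ (in one-line notation) with no subsequence $\pi_j,\pi_{j+1},\pi_k$ such that $j+1<k$, $\pi_j=\pi_k+1$, and $\pi_{j+1}>\pi_j$. $F_n(321,3124)$ is the set of Fishburn permutations of length $n$ avoiding the classical patterns $321$ and $3124$ (i.e. having no subsequence with the same relative order as either). Labels: a permutation $\pi\in F_n(321,3124)$ with $n\ge1$ has label (1a) if $n\ge 2$, $\pi_{n-1}=n$ and $\pi_n=n-1$; (1b) if $\pi$ contains $312$; (k), for an integer $k\ge2$, if $\pi$ avoids $312$ and either the rightmost $k$ entries of $\pi$ are $a,n-k+2,n-k+3,\ldots,n$ with $a\le n-k$, or $\pi=12\cdots n$ and $k=n+1$. The empty permutation is given label (1a). *)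

(* Defs.v *)
From mathcomp Require Import all_boot all_order all_algebra all_fingroup.
Set Implicit Arguments.
Unset Strict Implicit.
Unset Printing Implicit Defensive.

(* fib_shift m is F_(m-2), i.e. 1, 0, 1, 1, 2, 3, 5, ... *)
Fixpoint fib_shift (m : nat) : nat :=
  match m with
  | 0 => 1
  | 1 => 0
  | (m''.+1 as m').+1 => fib_shift m' + fib_shift m''
  end.

Definition Fib (z : int) : nat :=
  match (z + 2)%R with
  | Posz m => fib_shift m
  | Negz _ => 0
  end.

(* A permutation of length n is an element of 'S_n, so positions and values
   are counted from 0; one_line gives the word with entries 1, ..., n. *)
Definition one_line (n : nat) (pi : 'S_n) : seq nat :=
  [seq (val (pi i)).+1 | i <- enum 'I_n].

Definition contains_pattern (n : nat) (p : seq nat) (pi : 'S_n) : bool :=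
  [exists f : {ffun 'I_(size p) -> 'I_n},
    [forall i : 'I_(size p), forall j : 'I_(size p),
      ((i < j) ==> (f i < f j)) &&
      ((pi (f i) < pi (f j)) == (nth 0 p i < nth 0 p j))]].

Definition avoids_pattern (n : nat) (p : seq nat) (pi : 'S_n) : bool :=
  ~~ contains_pattern p pi.

(* j1 is the position j + 1, which must exist. *)
Definition fishburn (n : nat) (pi : 'S_n) : bool :=
  ~~ [exists j : 'I_n, exists j1 : 'I_n, exists k : 'I_n,
       [&& val j1 == j.+1, j.+1 < k,
           val (pi j) == (pi k).+1 & pi j < pi j1]].

Definition Fishburn_321_3124 (n : nat) : {set 'S_n} :=
  [set pi : 'S_n | [&& fishburn pi, avoids_pattern [:: 3; 2; 1] pi
                     & avoids_pattern [:: 3; 1; 2; 4] pi]].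

Inductive label : Type :=
  | Label1a
  | Label1b
  | LabelK of nat.

(* drop (n - k) (one_line pi) is the word of the rightmost k entries when
   k <= n. *)
Definition has_label (n : nat) (y : label) (pi : 'S_n) : bool :=
  match y with
  | Label1a =>
      (n == 0) || ((2 <= n) && (drop (n - 2) (one_line pi) == [:: n; n - 1]))
  | Label1b => contains_pattern [:: 3; 1; 2] pi
  | LabelK k =>
      [&& 2 <= k, avoids_pattern [:: 3; 1; 2] pi &
        ((k <= n) &&
          [exists a : 'I_(n - k).+1,
            drop (n - k) (one_line pi) ==
              val a :: iota (n - k + 2) (k - 1)])
        || ((one_line pi == iota 1 n) && (k == n + 1))]
  end.

Definition label_count (y : label) (n : nat) : nat :=
  #|[set pi in Fishburn_321_3124 n | has_label y pi]|.

(* Main.v *)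
(* Let pi be a permutation in the class with first entry c.  If c = 1, the rest
   of pi is an arbitrary shifted member of the class.  If c > 1, the entries
   below c increase because 321 is avoided; an ascent after c would make c, the
   second entry and c - 1 violate the Fishburn condition, so the second entry is
   1.  If c = 2, what follows 2 1 is again arbitrary.  If c > 2, avoiding 3124
   puts every entry above c before 2, and avoiding 321 sorts those entries, so
   pi = c 1 c+1 ... n 2 ... c-1.  Hence the class has the counting recursion
   T(n+2) = T(n+1) + T(n) + n.  The first two operations preserve the labels up
   to small cases, and the words of the third kind all have label (1b). *)
Require Import Defs.
From mathcomp Require Import all_boot all_order all_algebra all_fingroup.
From mathcomp Require Import zify.

(** * Pattern containment and the Fishburn condition for words *)

Definition order_iso (s p : seq nat) : bool :=
  (size s == size p) &&
  [forall i : 'I_(size p), forall j : 'I_(size p),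
     (nth 0 s i < nth 0 s j) == (nth 0 p i < nth 0 p j)].

(** Masks of a fixed length form a finite type, so quantifying over them instead of over
    subsequences keeps containment boolean. *)
Definition word_contains (p w : seq nat) : bool :=
  [exists m : (size w).-tuple bool, order_iso (mask m w) p].

(* The default value of [head] is harmless: it is used only when [behead w'] is
   empty. *)
Fixpoint word_fishburn (w : seq nat) : bool :=
  if w is x :: w' then
    ~~ ((x < head 0 w') && (x \in [seq y.+1 | y <- behead w']))
      && word_fishburn w'
  else true.

Definition word_in_class (w : seq nat) : bool :=
  [&& word_fishburn w, ~~ word_contains [:: 3; 2; 1] w
    & ~~ word_contains [:: 3; 1; 2; 4] w].

Lemma order_isoP s p :
  reflect (size s = size p /\ forall i j, i < size p -> j < size p ->
             (nth 0 s i < nth 0 s j) = (nth 0 p i < nth 0 p j))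
          (order_iso s p).
Proof.
apply: (iffP andP) => [[/eqP sz /forallP h]|[sz h]]; split=> //.
- move=> i j hi hj; have /forallP h' := h (Ordinal hi).
  exact: eqP (h' (Ordinal hj)).
- by apply/eqP.
- by apply/forallP=> i; apply/forallP=> j; apply/eqP/h.
Qed.

Lemma word_containsP p w :
  reflect (exists2 s, subseq s w & order_iso s p) (word_contains p w).
Proof.
apply: (iffP existsP) => [[m h]|[s /subseqP[m szm ->] h]].
  by exists (mask m w) => //; apply: mask_subseq.
by exists (Tuple (introT eqP szm)).
Qed.

Lemma order_iso_addn k s p :
  order_iso [seq k + x | x <- s] p = order_iso s p.
Proof.
apply/order_isoP/order_isoP; rewrite size_map => -[sz h]; split=> // i j hi hj;
  move: (h i j hi hj); by rewrite !(nth_map 0) ?sz // ltn_add2l.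
Qed.

Lemma word_contains_addn p k w :
  word_contains p [seq k + x | x <- w] = word_contains p w.
Proof.
apply/word_containsP/word_containsP => [[s]|[s hs iso]].
  case/subseqP=> m szm ->; rewrite -map_mask order_iso_addn => iso.
  by exists (mask m w) => //; apply: mask_subseq.
by exists [seq k + x | x <- s]; rewrite ?map_subseq ?order_iso_addn.
Qed.

(** In an occurrence that starts at [x], this letter plays the role of [p0], so [w] must supply as
    many letters below [x] as [p] has entries below [p0]. The hypothesis says that there are too
    few. *)
Lemma word_contains_cons p0 p x w :
  count (ltn^~ x) w < count (ltn^~ p0) p ->
  word_contains (p0 :: p) (x :: w) = word_contains (p0 :: p) w.
Proof.
move=> lt_ct; apply/word_containsP/word_containsP => -[s ss iso]; last first.
  by exists s => //; apply: subseq_trans ss (subseq_cons _ _).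
exists s => //; case: s ss iso => [|y s]; first by rewrite sub0seq.
rewrite /=; case: eqP => // -> ss /order_isoP[/= [sz] h].
suff eq_ct : count (ltn^~ x) s = count (ltn^~ p0) p.
  by move: lt_ct; rewrite -eq_ct ltnNge leq_count_subseq.
have: map (ltn^~ x) s = map (ltn^~ p0) p.
  apply: (@eq_from_nth _ false); first by rewrite !size_map.
  rewrite size_map => i hi; rewrite !(nth_map 0) -?sz //.
  by have := h i.+1 0; rewrite /= ltnS -sz => ->.
by move/(congr1 (count id)); rewrite !count_map.
Qed.

Lemma word_contains_nil p0 p : word_contains (p0 :: p) [::] = false.
Proof. by apply/word_containsP => -[s]; rewrite subseq0 => /eqP->. Qed.

Lemma word_contains321P w :
  reflect (exists x y z, subseq [:: x; y; z] w /\ z < y < x)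
          (word_contains [:: 3; 2; 1] w).
Proof.
apply: (iffP (word_containsP _ _)) => [[s ss /order_isoP[sz h]]|].
  case: s sz ss h => [|x [|y [|z []]]] // _ ss h; exists x, y, z.
  by split=> //; have := h 1 0; have := h 2 1; rewrite /= => -> // ->.
case=> x [y [z [ss xyz]]]; exists [:: x; y; z] => //.
apply/order_isoP; split=> // -[|[|[|i]]] [|[|[|j]]] //= _ _; lia.
Qed.

Lemma word_contains3124P w :
  reflect (exists x y z t, subseq [:: x; y; z; t] w
             /\ [/\ y < z, z < x & x < t])
          (word_contains [:: 3; 1; 2; 4] w).
Proof.
apply: (iffP (word_containsP _ _)) => [[s ss /order_isoP[sz h]]|].
  case: s sz ss h => [|x [|y [|z [|t []]]]] // _ ss h; exists x, y, z, t.
  split=> //; have := h 1 2; have := h 2 0; have := h 0 3.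
  by rewrite /= => -> // -> // -> //.
case=> x [y [z [t [ss [? ? ?]]]]]; exists [:: x; y; z; t] => //.
apply/order_isoP; split=> // -[|[|[|[|i]]]] [|[|[|[|j]]]] //= _ _; lia.
Qed.

(** * Passage between permutations and words *)

Lemma size_one_line n (pi : 'S_n) : size (one_line pi) = n.
Proof. by rewrite size_map size_enum_ord. Qed.

Lemma nth_one_line {n} (pi : 'S_n) (i : 'I_n) :
  nth 0 (one_line pi) i = (pi i).+1.
Proof. by rewrite (nth_map i) ?size_enum_ord // nth_ord_enum. Qed.

Lemma one_line_inj n : injective (@one_line n).
Proof.
move=> p q /(congr1 (fun w => nth 0 w)) eq_pq; apply/permP=> i; apply: val_inj.
by apply: succn_inj; rewrite -!nth_one_line eq_pq.
Qed.

Lemma perm_one_line n (pi : 'S_n) : perm_eq (one_line pi) (iota 1 n).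
Proof.
have inj : injective (fun i => (val (pi i)).+1).
  by move=> i j /succn_inj/val_inj/perm_inj.
apply: uniq_perm => [||x].
- by rewrite (map_inj_uniq inj) enum_uniq.
- exact: iota_uniq.
rewrite mem_iota; apply/mapP/idP => [[i _ ->]|]; first by rewrite /= add1n ltnS.
case: x => // x /=; rewrite add1n ltnS => lt_xn.
by exists ((pi^-1)%g (Ordinal lt_xn)); rewrite ?mem_enum ?permKV.
Qed.

Lemma one_line_surj n w :
  perm_eq w (iota 1 n) -> exists pi : 'S_n, one_line pi = w.
Proof.
move=> pw; have szw : size w = n by rewrite (perm_size pw) size_iota.
have uw : uniq w by rewrite (perm_uniq pw) iota_uniq.
have w_rng i : i < n -> 0 < nth 0 w i <= n.
  move=> hi; have : nth 0 w i \in w by rewrite mem_nth ?szw.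
  by rewrite (perm_mem pw) mem_iota add1n.
(* The default [i] of [insubd] is never taken: by [w_rng] the decremented entry is below [n]. *)
pose f (i : 'I_n) : 'I_n := insubd i (nth 0 w i).-1.
have fE i : (f i).+1 = nth 0 w i.
  have := w_rng i (ltn_ord i); rewrite val_insubd; case: ifP; lia.
have f_inj : injective f.
  move=> i j eq_f; apply/val_inj/eqP => /=.
  by rewrite -(nth_uniq 0 _ _ uw) ?szw // -!fE eq_f.
exists (perm f_inj); apply: (@eq_from_nth _ 0); rewrite size_one_line ?szw //.
by move=> i hi; rewrite (nth_one_line _ (Ordinal hi)) permE fE.
Qed.

Lemma contains_patternE n p (pi : 'S_n) :
  contains_pattern p pi = word_contains p (one_line pi).
Proof.
apply/existsP/word_containsP => [[f /forallP h]|[s ss /order_isoP[sz h]]].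
  have f_mono (i j : 'I_(size p)) : i < j -> f i < f j.
    by have /forallP/(_ j)/andP[/implyP] := h i.
  have eq_f (i j : 'I_(size p)) :
      (pi (f i) < pi (f j)) = (nth 0 p i < nth 0 p j).
    by have /forallP/(_ j)/andP[_ /eqP] := h i.
  exists [seq (val (pi (f i))).+1 | i <- enum 'I_(size p)].
    rewrite (map_comp (fun i => (val (pi i)).+1) f) map_subseq //.
    (* The positions chosen by [f] increase strictly, so their list equals the enumeration of all
       positions filtered by membership in it, and a filtered list is a subsequence. *)
    pose r (i j : 'I_n) := i < j.
    have r_tr : transitive r by move=> ? ? ?; apply: ltn_trans.
    have r_irr : irreflexive r by move=> i; rewrite /r ltnn.
    have srt m : sorted (fun i j : 'I_m => i < j) (enum 'I_m).
      by have := iota_ltn_sorted 0 m; rewrite -val_enum_ord sorted_map.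
    have srt_f : sorted r (map f (enum 'I_(size p))).
      by rewrite sorted_map; apply: sub_sorted (srt _) => i j /f_mono.
    pose t := [seq i <- enum 'I_n | i \in map f (enum 'I_(size p))].
    rewrite (irr_sorted_eq r_tr r_irr srt_f (s2 := t)).
    - exact: filter_subseq.
    - exact: sorted_filter (srt n).
    - by move=> i; rewrite mem_filter mem_enum andbT.
  set s := map _ _; have nth_s (i : 'I_(size p)) : nth 0 s i = (pi (f i)).+1.
    by rewrite (nth_map i) ?size_enum_ord // nth_ord_enum.
  apply/order_isoP; rewrite size_map size_enum_ord; split=> // i j hi hj.
  by rewrite (nth_s (Ordinal hi)) (nth_s (Ordinal hj)) ltnS eq_f.
(* Conversely, the mask that cuts [s] out of the word, applied to the list of positions, gives the
   increasing list [t] from which the embedding is read. *)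
case/subseqP: ss => m szm def_s; rewrite -map_mask in def_s.
set t := mask m (enum 'I_n) in def_s.
have szt : size t = size p by rewrite -sz def_s size_map.
have srt : sorted ltn (map val t).
  rewrite /t map_mask val_enum_ord; apply: sorted_mask; first exact: ltn_trans.
  exact: iota_ltn_sorted.
have lt_t (i : 'I_(size p)) : i < size (in_tuple t) by rewrite szt.
pose f (i : 'I_(size p)) := tnth (in_tuple t) (Ordinal (lt_t i)).
have val_f i : val (f i) = nth 0 (map val t) i.
  by rewrite (nth_map (f i)) ?szt //; congr val; apply: tnth_nth.
have pi_f i : (pi (f i)).+1 = nth 0 s i.
  rewrite def_s (nth_map (f i)) ?szt //; congr (val (pi _)).+1.
  exact: tnth_nth.
exists [ffun i => f i].
apply/forallP=> i; apply/forallP=> j; rewrite !ffunE.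
have -> : (pi (f i) < pi (f j)) = (nth 0 p i < nth 0 p j).
  by rewrite -ltnS !pi_f h.
rewrite eqxx andbT.
apply/implyP=> lt_ij.
rewrite !val_f; apply: (sorted_ltn_nth ltn_trans) => //.
  by rewrite inE size_map szt.
by rewrite inE size_map szt.
Qed.

Lemma word_fishburnP w :
  reflect (forall j k, j.+1 < k < size w -> nth 0 w j = (nth 0 w k).+1 ->
             nth 0 w j.+1 <= nth 0 w j)
          (word_fishburn w).
Proof.
elim: w => [|x w ih] /=; first by constructor; case=> [|j] [|k].
apply: (iffP andP) => [[h1 /ih h2] [|j] [|k] // /andP[hjk hk] /= eq_jk|h].
- rewrite leqNgt; apply: contraNN h1 => hlt; rewrite -nth0 hlt eq_jk /=.
  rewrite map_f //; case: k hjk hk eq_jk hlt => // k _ hk eq_jk hlt.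
  rewrite -nth_behead mem_nth // size_behead; move: hk; rewrite !ltnS.
  by case: (size w).
- by apply: h2 eq_jk; apply/andP.
split; last by apply/ih => j k hjk; apply: (h j.+1 k.+1).
apply/negP=> /andP[hlt /mapP[y /(nthP 0)[k hk <-] eq_x]].
have hk2 : k.+2 < (size w).+1 by move: hk; rewrite size_behead; case: (size w).
have := h 0 k.+2; rewrite /= -nth_behead nth0 => /(_ hk2 eq_x).
by rewrite leqNgt hlt.
Qed.

Lemma fishburnE n (pi : 'S_n) : fishburn pi = word_fishburn (one_line pi).
Proof.
apply/idP/word_fishburnP => [h j k|h].
  rewrite size_one_line => /andP[hjk hk] eq_jk; rewrite leqNgt.
  apply: contraNN h => hlt.
  have hj1 := ltn_trans hjk hk; have hj := ltn_trans (ltnSn j) hj1.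
  apply/existsP; exists (Ordinal hj); apply/existsP; exists (Ordinal hj1).
  apply/existsP; exists (Ordinal hk); rewrite /= eqxx hjk /=.
  move: eq_jk hlt; rewrite (nth_one_line _ (Ordinal hj)).
  rewrite (nth_one_line _ (Ordinal hj1)) (nth_one_line _ (Ordinal hk)).
  by rewrite ltnS => -[->] ->; rewrite eqxx.
apply/existsP=> -[j /existsP[j1 /existsP[k]]].
case/and4P=> /eqP hj1 hjk /eqP eq_jk hlt.
have := h j k; rewrite size_one_line hjk ltn_ord !nth_one_line eq_jk.
move=> /(_ erefl erefl); rewrite -hj1 nth_one_line -eq_jk.
by rewrite ltnS leqNgt hlt.
Qed.

Lemma Fishburn_321_3124E n (pi : 'S_n) :
  (pi \in Fishburn_321_3124 n) = word_in_class (one_line pi).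
Proof. by rewrite inE fishburnE /avoids_pattern !contains_patternE. Qed.

(** * The three constructions and their closure properties *)

Definition ext1 (w : seq nat) : seq nat := 1 :: [seq 1 + x | x <- w].
Definition ext21 (w : seq nat) : seq nat := 2 :: 1 :: [seq 2 + x | x <- w].
Definition block (n c : nat) : seq nat :=
  c :: 1 :: iota c.+1 (n - c) ++ iota 2 (c - 2).

Fixpoint class_words (n : nat) : seq (seq nat) :=
  match n with
  | 0 => [:: [::]]
  | 1 => [:: [:: 1]]
  | (m.+1 as m').+1 =>
      map ext1 (class_words m') ++ map ext21 (class_words m)
        ++ map (block m.+2) (iota 3 m)
  end.

Lemma class_wordsSS n :
  class_words n.+2 = map ext1 (class_words n.+1) ++ map ext21 (class_words n)
    ++ map (block n.+2) (iota 3 n).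
Proof. by []. Qed.

(** Used to turn avoidance of 321 into sortedness: a forbidden descent is excluded one two-letter
    subsequence at a time. *)
Lemma subseq_pairwise2 {T : eqType} (r : rel T) w :
  (forall u v, subseq [:: u; v] w -> r u v) -> pairwise r w.
Proof.
elim: w => //= x w ih h; apply/andP; split.
  by apply/allP => y yw; apply: h; rewrite eqxx sub1seq.
apply: ih => u v ss; apply: h; exact: subseq_trans ss (subseq_cons _ _).
Qed.

Lemma pairwise_iota (r : rel nat) m k :
  (forall u v, m <= u -> u < v -> v < m + k -> r u v) -> pairwise r (iota m k).
Proof.
move=> h; apply/(pairwiseP 0) => i j; rewrite !inE size_iota => hi hj lt_ij.
rewrite !nth_iota //; apply: h; lia.
Qed.

(** The new letter 1 has nothing below it, while an occurrence starting there would need a smaller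
    letter. *)
Lemma word_contains_ext1 p0 p w :
  all (leq 1) w -> 0 < count (ltn^~ p0) p ->
  word_contains (p0 :: p) (ext1 w) = word_contains (p0 :: p) w.
Proof.
move=> w_gt0 hp; rewrite word_contains_cons ?word_contains_addn //.
rewrite (_ : count _ _ = 0) //; apply/eqP; rewrite -leqn0 leqNgt -has_count.
by apply/hasPn => _ /mapP[x /(allP w_gt0)/= x0 ->]; lia.
Qed.

(** Only the letter 1 lies below the new 2, and nothing lies below that 1. The hypothesis asks for
    two smaller entries, as in 321, 3124 and 312. *)
Lemma word_contains_ext21 p0 p w :
  all (leq 1) w -> 1 < count (ltn^~ p0) p ->
  word_contains (p0 :: p) (ext21 w) = word_contains (p0 :: p) w.
Proof.
move=> w_gt0 hp.
have ct (m : nat) : m <= 2 -> count (ltn^~ m) [seq 2 + x | x <- w] = 0.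
  move=> hm; apply/eqP; rewrite -leqn0 leqNgt -has_count.
  by apply/hasPn => _ /mapP[x /(allP w_gt0)/= x0 ->]; lia.
by rewrite !word_contains_cons ?word_contains_addn /= ?ct // ltnW.
Qed.

Lemma word_fishburn_addn k w :
  word_fishburn [seq k + x | x <- w] = word_fishburn w.
Proof.
elim: w => //= x w ->; congr (~~ (_ && _) && _).
  by case: w => //= y w; rewrite ltn_add2l.
rewrite behead_map -map_comp (eq_map (g := addn k \o succn)).
  by rewrite map_comp mem_map //; apply: addnI.
by move=> y /=; rewrite addnS.
Qed.

(** A violation starting at the letter 1 would need a later letter 0. *)
Lemma word_fishburn1 w :
  all (leq 1) w -> word_fishburn (1 :: w) = word_fishburn w.
Proof.
move=> w_gt0 /=; case: mapP => [[y /mem_behead/(allP w_gt0)/= y0 [e]]|_].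
  by rewrite -e in y0.
by rewrite andbF.
Qed.

Lemma word_in_class_ext1 w :
  all (leq 1) w -> word_in_class (ext1 w) = word_in_class w.
Proof.
move=> w_gt0; rewrite /word_in_class !word_contains_ext1 // word_fishburn1.
  by rewrite word_fishburn_addn.
by apply/allP => _ /mapP[x _ ->].
Qed.

Lemma word_in_class_ext21 w :
  all (leq 1) w -> word_in_class (ext21 w) = word_in_class w.
Proof.
move=> w_gt0; rewrite /word_in_class !word_contains_ext21 //.
(* The prefix 2 1 is a descent, so the leading 2 starts no violation and its test computes away. *)
rewrite [word_fishburn (ext21 w)]/= -/(word_fishburn (1 :: _)) word_fishburn1.
  by rewrite word_fishburn_addn.
by apply/allP => _ /mapP[x _ ->].
Qed.

Lemma perm_iota_gt0 n w : perm_eq w (iota 1 n) -> all (leq 1) w.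
Proof.
move=> pw; apply/allP=> x; rewrite (perm_mem pw) mem_iota; by case/andP.
Qed.

Lemma perm_ext1 n w :
  perm_eq (ext1 w) (iota 1 n.+1) = perm_eq w (iota 1 n).
Proof.
rewrite /ext1 /= perm_cons (iotaDl 1 1); apply/idP/idP; last exact: perm_map.
exact/perm_map_inj/addnI.
Qed.

Lemma perm_ext21 n w :
  perm_eq (ext21 w) (iota 1 n.+2) = perm_eq w (iota 1 n).
Proof.
rewrite /ext21 (perm_catCA [:: 2] [:: 1]) /= !perm_cons (iotaDl 2 1).
apply/idP/idP; last exact: perm_map; exact/perm_map_inj/addnI.
Qed.

Lemma perm_block n c : 3 <= c <= n -> perm_eq (block n c) (iota 1 n).
Proof.
move=> hc; apply: uniq_perm; rewrite ?iota_uniq //=.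
  rewrite cat_uniq !iota_uniq !inE !mem_cat !mem_iota andbT /=.
  apply/and3P; split; [lia|lia|apply/hasPn=> x; rewrite /= !mem_iota; lia].
by move=> x; rewrite !inE mem_cat !mem_iota; lia.
Qed.

(** Both patterns are excluded by one relation [r] between an earlier and a later letter: letters
    below [c] increase, letters from [c] on increase, and no letter strictly between 1 and [c]
    precedes one above [c]. Hence every descent falls from at least [c] to below [c], and two
    descents cannot be chained into a 321. *)
Lemma word_in_class_block n c : 3 <= c <= n -> word_in_class (block n c).
Proof.
move=> hc.
have pw_fish w : pairwise (fun x y => x != y.+1) w -> word_fishburn w.
  elim: w => //= x w ih /andP[/allP hx /ih ->]; rewrite andbT.
  apply/negP=> /andP[_ /mapP[y /mem_behead/hx/eqP ne_xy /ne_xy[]]].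
have [hA hD] : (forall x, x \in iota c.+1 (n - c) -> c < x)
    /\ (forall x, x \in iota 2 (c - 2) -> 1 < x < c).
  by split=> y; rewrite mem_iota; lia.
pose r u v := [&& (u < c) ==> (v < c) ==> (u < v),
  (c <= u) ==> (c <= v) ==> (u < v) & ~~ [&& 1 < u, u < c & c < v]].
have pw_block : pairwise r (block n c).
  rewrite /= pairwise_cat !all_cat !andbA; do !(apply/andP; split).
  all: try by rewrite /r; lia.
  all: try by apply: pairwise_iota => u v /=; rewrite /r; lia.
  all: try by apply/allP => y /hA /=; rewrite /r; lia.
  all: try by apply/allP => y /hD /=; rewrite /r; lia.
  all: try by apply/allrelP => y z /hA ? /hD /=; rewrite /r; lia.
have in_pw s : subseq s (block n c) -> pairwise r s.
  by move=> /subseq_pairwise; apply.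
have r_desc u v : r u v -> v < u -> v < c <= u by rewrite /r; lia.
have ge1 s : subseq s (block n c) -> all (leq 1) s.
  move/mem_subseq=> ss; apply/allP => x /ss; move: x; apply/allP.
  exact: perm_iota_gt0 (perm_block _ _ hc).
apply/and3P; split.
- rewrite /= (_ : c < 1 = false) /=; last lia.
  apply/andP; split.
    apply/negP=> /andP[_ /mapP[y /mem_behead]]; rewrite mem_cat.
    by case/orP=> [/hA|/hD]; lia.
  (* In the tail no letter is the successor of a later one: each of the two runs increases, and the
     missing value [c] separates them. *)
  apply: pw_fish; rewrite pairwise_cat; apply/and3P; split.
  + by apply/allrelP => x y /hA ? /hD; lia.
  + by apply: pairwise_iota => u v; lia.
  + by apply: pairwise_iota => u v; lia.
- apply/word_contains321P => -[x [y [z [/in_pw/= + /andP[lt_zy lt_yx]]]]].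
  case/and3P => /and3P[/r_desc/(_ lt_yx) ? _ _] /andP[/r_desc/(_ lt_zy)].
  by lia.
(* The two descents from [x] give [z < c <= x < t], and [y >= 1] forces [z > 1], so the pair [z],
   [t] breaks the last clause of [r]. *)
apply/word_contains3124P => -[x [y [z [t [ss [? ? ?]]]]]].
case/and4P: (in_pw _ ss) => /and4P[/r_desc r_xy /r_desc r_xz _ _].
move=> _ /andP[/and3P[_ _ /negP]] + _ _; apply.
by case/and5P: (ge1 _ ss); lia.
Qed.

(** * Classification of the words in the class *)

Lemma word_in_class_cases n w :
  perm_eq w (iota 1 n.+2) -> word_in_class w ->
  [\/ exists u, w = ext1 u, exists u, w = ext21 u
    | exists2 c, 3 <= c <= n.+2 & w = block n.+2 c].
Proof.
move=> pw /and3P[fw no321 no3124].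
have mem_w x : (x \in w) = (0 < x < n.+3) by rewrite (perm_mem pw) mem_iota.
(* The truncated subtraction loses nothing on letters that are at least [k]; this yields the
   preimages under [ext1] and [ext21]. *)
have sub_addn k v :
    all (leq k) v -> v = [seq k + x | x <- [seq x - k | x <- v]].
  move=> /allP hv; rewrite -map_comp -[LHS]map_id.
  apply/eq_in_map => x /hv /= hx.
  by rewrite subnKC.
have : uniq w by rewrite (perm_uniq pw) iota_uniq.
move: pw fw no321 no3124 mem_w; case: w => [|c [|d v]] /perm_size //= _.
move=> /andP[fcd _] no321 no3124 mem_w /and3P[]; rewrite inE negb_or.
move=> /andP[/eqP ne_cd cv] dv uv.
have hc : 0 < c < n.+3 by rewrite -mem_w inE eqxx.
have in_v x : x \in v -> [/\ x != c, x != d & 0 < x < n.+3].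
  move=> xv; rewrite -mem_w !inE xv !orbT; split=> //.
    by apply: contraNneq cv => <-.
  by apply: contraNneq dv => <-.
have [c1|c1] := eqVneq c 1.
  apply: Or31; exists [seq x - 1 | x <- d :: v]; rewrite c1 /ext1 -sub_addn //.
  apply/allP => x xdv; have := mem_w x; rewrite inE xdv orbT; lia.
have lt_dc : d < c.
  rewrite ltnNge leq_eqVlt; apply/negP=> /orP[/eqP //|lt_cd].
  move/negP: fcd; rewrite lt_cd; apply; apply/mapP; exists c.-1; last lia.
  by have := mem_w c.-1; rewrite !inE; lia.
have d1 : d = 1.
  have := mem_w d; have := mem_w 1; rewrite !inE eqxx orbT => h1 hd.
  have [//|ne_d1] := eqVneq d 1.
  (* If the second letter [d] were not 1, then [c], [d], 1 would form a 321. *)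
  case/word_contains321P: no321; exists c, d, 1.
  by rewrite /= !eqxx sub1seq; split; lia.
subst d.
have [c2|c2] := eqVneq c 2.
  apply: Or32; exists [seq x - 2 | x <- v]; rewrite c2 /ext21 -sub_addn //.
  by apply/allP => x /in_v[]; lia.
have v2 : 2 \in v by move: (mem_w 2); rewrite !inE eq_sym (negPf c2) /= => ->.
apply: Or33; exists c; first lia.
have sub_w s : subseq s v -> subseq s [:: c, 1 & v].
  move=> ss; apply: subseq_trans ss _.
  exact: subseq_trans (subseq_cons _ _) (subseq_cons _ _).
have sub_cw s : subseq s v -> subseq (c :: s) [:: c, 1 & v].
  by move=> ss; rewrite /= eqxx; apply: subseq_trans ss (subseq_cons _ _).
(* The letter 2 cuts the rest of the word into [A] and [D]. The aim is to show that [A] is the run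
   above [c] and [2 :: D] the run from 2 to [c - 1]. *)
move: uv in_v mem_w cv dv sub_w sub_cw no321 no3124; case/splitPr: v2 => A D.
move=> uv in_v mem_w cv dv sub_w sub_cw.
move=> /word_contains321P no321 /word_contains3124P no3124.
have hA x : x \in A -> c < x.
  move=> xA; have [|/eqP ne_xc /eqP ne_x1 x_gt0] := in_v x.
    by rewrite mem_cat xA.
  have ne_x2 : x != 2.
    by apply: contraTneq uv => <-; rewrite cat_uniq /= xA andbF.
  (* A letter of [A] below [c] would give the 321 formed by [c], [x], 2. *)
  rewrite ltnNge; apply/negP=> le_xc; apply: no321.
  exists c, x, 2; split; last lia.
  apply: sub_cw; apply: (@cat_subseq _ [:: x] [:: 2] A (2 :: D)).
    by rewrite sub1seq.
  by rewrite sub1seq inE eqxx.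
have hD x : x \in D -> x < c.
  move=> xD; have [|/eqP ne_xc _ x_gt0] := in_v x.
    by rewrite mem_cat inE xD !orbT.
  (* A letter of [D] above [c] would give the 3124 formed by [c], 1, 2, [x]. *)
  rewrite ltnNge leq_eqVlt; apply/negP=> /orP[/eqP/esym//|lt_cx]; apply: no3124.
  exists c, 1, 2, x; split; last by split=> //; lia.
  rewrite /= !eqxx; apply: (@cat_subseq _ [::] [:: 2; x] A (2 :: D)).
    exact: sub0seq.
  by rewrite /= sub1seq.
have uA : uniq A by move: uv; rewrite cat_uniq => /andP[].
have u2D : uniq (2 :: D) by move: uv; rewrite cat_uniq => /and3P[].
(* A descent inside [A] followed by 2 is a 321; below, a descent inside [2 :: D] preceded by [c] is
   one. *)
have srtA : sorted ltn A.
  rewrite (sorted_pairwise ltn_trans); apply: subseq_pairwise2 => x y ss /=.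
  have : x != y by have := subseq_uniq ss uA; rewrite /= inE andbT.
  rewrite ltnNge leq_eqVlt => ne_xy; apply/negP=> /orP[/eqP eq_yx|lt_yx].
    by move/eqP: ne_xy => /(_ (esym eq_yx)).
  apply: no321; exists x, y, 2; split.
    apply: sub_w; apply: (@cat_subseq _ [:: x; y] [:: 2] A (2 :: D)) => //.
    by rewrite sub1seq inE eqxx.
  have /hA : y \in A by apply: (mem_subseq ss); rewrite !inE eqxx orbT.
  by lia.
have srtD : sorted ltn (2 :: D).
  rewrite (sorted_pairwise ltn_trans); apply: subseq_pairwise2 => x y ss.
  have : x != y by have := subseq_uniq ss u2D; rewrite /= inE andbT.
  rewrite /= ltnNge leq_eqVlt => ne_xy; apply/negP=> /orP[/eqP eq_yx|lt_yx].
    by move/eqP: ne_xy => /(_ (esym eq_yx)).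
  apply: no321; exists c, x, y; split.
    by apply: sub_cw; apply: subseq_trans ss (suffix_subseq _ _).
  rewrite lt_yx /=.
  have : x \in 2 :: D by apply: (mem_subseq ss); rewrite inE eqxx.
  by rewrite inE => /orP[/eqP->|/hD //]; lia.
have mem_v x : (x \in A) || (x \in 2 :: D) = [&& 1 < x, x != c & x < n.+3].
  rewrite -mem_cat; apply/idP/and3P => [/in_v[? ? ?]|[x1 /negPf x_c x_n]].
    by split=> //; lia.
  by move: (mem_w x); rewrite 2!inE x_c gtn_eqF // x_n ltnW //= => ->.
have {}hD x : x \in 2 :: D -> 1 < x < c.
  rewrite inE => /orP[/eqP->|xD]; first lia.
  by have := mem_v x; have := hD x xD; rewrite inE xD !orbT; lia.
(* Both pieces are strictly sorted, so each is determined by its set of letters, which [mem_v]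
   together with the bounds [hA] and [hD] identifies. *)
rewrite /block; congr [:: c, 1 & _ ++ _].
  apply: (irr_sorted_eq ltn_trans ltnn) (iota_ltn_sorted _ _) _ => // x.
  rewrite mem_iota; apply/idP/idP => [xA|hx].
    by have := mem_v x; have := hA x xA; rewrite xA /=; lia.
  by have/orP[//|/hD] : (x \in A) || (x \in 2 :: D); rewrite ?mem_v; lia.
apply: (irr_sorted_eq ltn_trans ltnn) (iota_ltn_sorted _ _) _ => // x.
rewrite mem_iota; apply/idP/idP => [/hD|hx]; first lia.
by have/orP[/hA|//] : (x \in A) || (x \in 2 :: D); rewrite ?mem_v; lia.
Qed.

(** * The list of all words in the class *)

Lemma word_in_class_nil : word_in_class [::].
Proof. by rewrite /word_in_class !word_contains_nil. Qed.

(** The induction is strong because the recursion reaches back two lengths. The closure lemmas show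
    that every listed word belongs to the class, and [word_in_class_cases] that none is missed. *)
Lemma mem_class_words n w :
  (w \in class_words n) = perm_eq w (iota 1 n) && word_in_class w.
Proof.
have [m] := ubnP n; elim: m n w => // m ih [|[|n]] w hn.
- rewrite inE; apply/eqP/andP => [->|[/perm_size/size0nil //]].
  by rewrite word_in_class_nil.
- rewrite inE; apply/eqP/andP => [->|[pw _]].
    split=> //.
    by rewrite -[[:: 1]]/(ext1 [::]) word_in_class_ext1 // word_in_class_nil.
  exact: perm_small_eq pw.
have ih1 u := ih n.+1 u hn; have ih0 u := ih n u (ltnW hn).
rewrite class_wordsSS !mem_cat; apply/or3P/andP => [[]|[pw cw]].
- case/mapP=> u; rewrite ih1 => /andP[pu cu] ->.
  by rewrite perm_ext1 word_in_class_ext1 // (perm_iota_gt0 _ _ pu).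
- case/mapP=> u; rewrite ih0 => /andP[pu cu] ->.
  by rewrite perm_ext21 word_in_class_ext21 // (perm_iota_gt0 _ _ pu).
- case/mapP=> c; rewrite mem_iota => hc ->.
  have hc' : 3 <= c <= n.+2 by lia.
  by rewrite perm_block // word_in_class_block.
case: (word_in_class_cases _ _ pw cw) => [[u def_w]|[u def_w]|[c hc ->]].
- rewrite def_w perm_ext1 in pw; rewrite def_w word_in_class_ext1 in cw.
    by apply: Or31; rewrite def_w map_f // ih1 pw.
  exact: perm_iota_gt0 pw.
- rewrite def_w perm_ext21 in pw; rewrite def_w word_in_class_ext21 in cw.
    by apply: Or32; rewrite def_w map_f // ih0 pw.
  exact: perm_iota_gt0 pw.
by apply: Or33; rewrite map_f // mem_iota; lia.
Qed.

Lemma ext1_inj : injective ext1.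
Proof. by move=> u v [/(inj_map (@addnI 1))]. Qed.

Lemma ext21_inj : injective ext21.
Proof. by move=> u v [/(inj_map (@addnI 2))]. Qed.

(** The first letter is 1, 2 or at least 3 in the three families, so they are disjoint, and each
    family is an injective image. *)
Lemma class_words_uniq n : uniq (class_words n).
Proof.
have [m] := ubnP n; elim: m n => // m ih [|[|n]] hn //.
have ih1 := ih n.+1 hn; have ih0 := ih n (ltnW hn).
have block_inj : injective (block n.+2) by move=> c d [].
rewrite class_wordsSS !cat_uniq (map_inj_uniq ext1_inj).
rewrite (map_inj_uniq ext21_inj) (map_inj_uniq block_inj) ih1 ih0 iota_uniq.
rewrite andbT /=.
apply/andP; split; apply/hasPn => w.
  rewrite mem_cat => w_tail; apply/mapP => -[u _ def_w].
  move: w_tail; rewrite def_w => /orP[/mapP[] //|/mapP[c]].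
  by rewrite mem_iota => hc [c1]; rewrite -c1 in hc.
case/mapP => c; rewrite mem_iota => hc ->; apply/mapP => -[u _ [c2 _]].
by rewrite c2 in hc.
Qed.

(** The predicate is arbitrary so that the lemma serves both the label counts and, with the constant
    true predicate, the size of the class. *)
Lemma card_class n (P : pred (seq nat)) :
  #|[set pi in Fishburn_321_3124 n | P (one_line pi)]|
    = count P (class_words n).
Proof.
rewrite cardE -(size_map (@one_line n)) -size_filter; apply: perm_size.
apply: uniq_perm.
- by rewrite (map_inj_uniq (@one_line_inj n)) enum_uniq.
- exact/filter_uniq/class_words_uniq.
move=> w; rewrite mem_filter mem_class_words; apply/mapP/and3P.
  case=> pi; rewrite mem_enum inE Fishburn_321_3124E => /andP[h1 h2] ->.
  by split=> //; apply: perm_one_line.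
case=> + /one_line_surj[pi def_w]; rewrite -def_w => hP cw; exists pi => //.
by rewrite mem_enum inE Fishburn_321_3124E cw.
Qed.

(** * Labels of words under the three constructions *)

(* The default value of [head] makes the test fail on an empty suffix, as the
   existential in [has_label] does. *)
Definition word_label (n : nat) (y : label) (w : seq nat) : bool :=
  match y with
  | Label1a => (n == 0) || ((2 <= n) && (drop (n - 2) w == [:: n; n - 1]))
  | Label1b => word_contains [:: 3; 1; 2] w
  | LabelK k =>
      [&& 2 <= k, ~~ word_contains [:: 3; 1; 2] w &
        [&& k <= n, head (n - k).+1 (drop (n - k) w) <= n - k
          & behead (drop (n - k) w) == iota (n - k + 2) (k - 1)]
        || ((w == iota 1 n) && (k == n + 1))]
  end.

Lemma exists_head_le m (s t : seq nat) :
  [exists a : 'I_m.+1, s == val a :: t] = (head m.+1 s <= m) && (behead s == t).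
Proof.
apply/existsP/andP => [[a /eqP->] /=|]; first by rewrite -ltnS ltn_ord.
case: s => [|x s] /= []; first by rewrite ltnn.
by rewrite -ltnS => hx /eqP->; exists (Ordinal hx).
Qed.

Lemma has_labelE n y (pi : 'S_n) :
  has_label y pi = word_label n y (one_line pi).
Proof.
case: y => [||k] //=; rewrite ?contains_patternE // /avoids_pattern.
by rewrite contains_patternE exists_head_le.
Qed.

Lemma label_countE y n :
  label_count y n = count (word_label n y) (class_words n).
Proof.
rewrite -card_class; apply: eq_card => pi.
by rewrite !inE has_labelE.
Qed.

Lemma size_class_word n w : w \in class_words n -> size w = n.
Proof.
by rewrite mem_class_words => /andP[/perm_size->]; rewrite size_iota.
Qed.

Lemma class_word_gt0 n w : w \in class_words n -> all (leq 1) w.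
Proof. by rewrite mem_class_words => /andP[/perm_iota_gt0]. Qed.

(** The common shape of the label recursions: the [n] blocks either all satisfy [P] or all fail it,
    as recorded by [b]. *)
Lemma count_class_words (P P1 P2 : pred (seq nat)) (b : bool) n :
  {in class_words n.+1, forall w, P (ext1 w) = P1 w} ->
  {in class_words n, forall w, P (ext21 w) = P2 w} ->
  (forall c, 3 <= c <= n.+2 -> P (block n.+2 c) = b) ->
  count P (class_words n.+2) =
    count P1 (class_words n.+1) + count P2 (class_words n) + b * n.
Proof.
move=> h1 h2 h3; rewrite class_wordsSS !count_cat !count_map addnA.
congr (_ + _ + _); [exact: eq_in_count|exact: eq_in_count|].
rewrite (@eq_in_count _ _ (fun=> b)) => [|c].
  by case: b {h3}; rewrite ?count_predT ?count_pred0 ?size_iota ?mul1n.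
by rewrite mem_iota => hc; apply: h3; lia.
Qed.

Lemma eq_map_addn k (s t : seq nat) :
  ([seq k + x | x <- s] == [seq k + x | x <- t]) = (s == t).
Proof. exact/inj_eq/inj_map/addnI. Qed.

Lemma word_label1a_ext1 n w :
  size w = n.+1 -> word_label n.+2 Label1a (ext1 w) = word_label n.+1 Label1a w.
Proof.
case: n => [|n] sz; first by case: w sz => [|x []].
rewrite /= !subSS !subn0 /= -map_drop.
exact: (eq_map_addn 1 _ [:: n.+2; n.+1]).
Qed.

(** For [n = 0] this uses the label (1a) of the empty permutation: [ext21 [::]] is the word 2 1,
    which ends in its largest letter followed by the next one. *)
Lemma word_label1a_ext21 n w :
  size w = n -> word_label n.+2 Label1a (ext21 w) = word_label n Label1a w.
Proof.
case: n => [/size0nil->|[|n] sz] //.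

rewrite /= !subSS !subn0 /= -map_drop.
exact: (eq_map_addn 2 _ [:: n.+2; n.+1]).
Qed.

(** The last letter is [c - 1], which equals [n + 1] only if [c = n + 2]; then the largest letter
    comes first in a word of at least three letters, hence not next to last. *)
Lemma word_label1a_block n c :
  3 <= c <= n.+2 -> word_label n.+2 Label1a (block n.+2 c) = false.
Proof.
move=> hc; apply/eqP => /= /(congr1 (fun s => (nth 0 s 0, nth 0 s 1))).
have [e2 e1] : n.+2 - 2 = n /\ n.+2 - 1 = n.+1 by lia.
rewrite !nth_drop addn0 addn1 e1 e2.
(* Length 3 is treated apart, since the last two letters of 3 1 2 include the 1; from length 4 on
   they both lie in the two runs. *)
case: n hc {e1 e2} => [|[|n]] hc; [lia|by have -> : c = 3 by lia|].
rewrite /= !nth_cat !size_iota => -[].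
case: ltnP => h1; case: ltnP => h2; rewrite !nth_iota; lia.
Qed.

Lemma word_contains312_block n c :
  3 <= c <= n.+2 -> word_contains [:: 3; 1; 2] (block n.+2 c).
Proof.
move=> hc; apply/word_containsP; exists [:: c; 1; 2].
  rewrite /= !eqxx sub1seq mem_cat !mem_iota; lia.
apply/order_isoP; split=> // -[|[|[|i]]] [|[|[|j]]] //= _ _; lia.
Qed.

(** Since [k <= n + 1], the last [k] letters are shifted letters of [w], and the bound on the first
    of them shifts along with it. *)
Lemma word_labelK_ext1 k n w :
  k <= n.+1 -> all (leq 1) w ->
  word_label n.+2 (LabelK k) (ext1 w) = word_label n.+1 (LabelK k) w.
Proof.
move=> hk w_gt0 /=; rewrite word_contains_ext1 //.
have [-> ->] : (k == n.+2 + 1 = false) /\ (k == n.+1 + 1 = false) by split; lia.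
rewrite !andbF !orbF subSn // [drop _ _]/= -map_drop hk leqW // behead_map.
rewrite -[(_ - k).+1 + 2]/(1 + (n.+1 - k + 2)) iotaDl eq_map_addn.
by case: (drop _ w).
Qed.

Lemma word_labelK_ext21 k n w :
  k <= n.+1 -> all (leq 1) w -> size w = n ->
  word_label n.+2 (LabelK k) (ext21 w) = word_label n (LabelK k) w.
Proof.
move=> hk w_gt0 sz /=; rewrite word_contains_ext21 //.
rewrite orbF (leq_trans hk) //=.
(* If [k = n + 1], the suffix is 1 followed by the shifted [w], so the suffix clause for [ext21 w]
   turns into the identity clause for [w]. *)
move: hk; rewrite leq_eqVlt => /orP[/eqP->|]; last rewrite ltnS => hk.
  rewrite ltnn !subSS subSnn addn1 eqxx andbT /=.
  by rewrite subn0 (iotaDl 2 1) eq_map_addn.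
have -> : (k == n + 1) = false by lia.
rewrite !andbF !orbF !subSn ?(leqW hk) // [drop _ _]/= -map_drop hk behead_map.
rewrite -[(_ - k).+2 + 2]/(2 + (n - k + 2)) iotaDl eq_map_addn.
by case: (drop _ w).
Qed.

Lemma iota_class_word n :
  word_in_class (iota 1 n) && ~~ word_contains [:: 3; 1; 2] (iota 1 n).
Proof.
elim: n => [|n ih]; first by rewrite word_in_class_nil word_contains_nil.
have gt0 : all (leq 1) (iota 1 n) by apply: perm_iota_gt0.
have -> : iota 1 n.+1 = ext1 (iota 1 n) by rewrite /ext1 -iotaDl.
by rewrite word_in_class_ext1 // word_contains_ext1.
Qed.

(** * Fibonacci recursions for the counts *)

Lemma fib_shiftSS m : fib_shift m.+2 = fib_shift m.+1 + fib_shift m.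
Proof. by []. Qed.

Lemma nat_ind2 (P : nat -> Prop) :
  P 0 -> P 1 -> (forall n, P n -> P n.+1 -> P n.+2) -> forall n, P n.
Proof.
move=> h0 h1 h n; suff [] : P n /\ P n.+1 by [].
by elim: n => // n [hn hn1]; split=> //; apply: h.
Qed.

Lemma label_count1a n : label_count Label1a n = fib_shift n.
Proof.
elim/nat_ind2: n => [||n ih ih1].
- by rewrite label_countE.
- by rewrite label_countE.
rewrite fib_shiftSS -ih -ih1 !label_countE.
rewrite (@count_class_words _ (word_label n.+1 Label1a) (word_label n Label1a)
  false).
- by rewrite mul0n addn0.
- by move=> w /size_class_word; apply: word_label1a_ext1.
- by move=> w /size_class_word; apply: word_label1a_ext21.
- exact: word_label1a_block.
Qed.

(** Adding [n + 1] absorbs the [n] blocks and leaves the pure Fibonacci recursion; it also avoids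
    truncated subtraction. The same correction works for the size of the whole class. *)
Lemma label_count1b n : label_count Label1b n + n.+1 = fib_shift n.+3.
Proof.
elim/nat_ind2: n => [||n ih ih1].
- by rewrite label_countE /= word_contains_nil.
- rewrite label_countE /= -[[:: 1]]/(ext1 [::]) word_contains_ext1 //.
  by rewrite word_contains_nil.
rewrite fib_shiftSS -ih -ih1 !label_countE.
rewrite (@count_class_words _ (word_label n.+1 Label1b) (word_label n Label1b)
  true).
- rewrite mul1n; lia.
- by move=> w /class_word_gt0 ?; apply: word_contains_ext1.
- by move=> w /class_word_gt0 ?; apply: word_contains_ext21.
- exact: word_contains312_block.
Qed.

Lemma size_class_words n : size (class_words n) + n.+1 = fib_shift n.+4.
Proof.
elim/nat_ind2: n => // n ih ih1.
rewrite fib_shiftSS -ih -ih1 class_wordsSS !size_cat !size_map size_iota.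
lia.
Qed.

Lemma label_countK_small n k : n.+1 < k -> label_count (LabelK k) n = 0.
Proof.
move=> hk; rewrite label_countE (@eq_count _ _ pred0) ?count_pred0 // => w /=.
by rewrite [k <= n]leqNgt (ltnW hk) (_ : k == n + 1 = false) ?andbF //; lia.
Qed.

(** The length is measured from [k - 1], the least one at which label (k) occurs, so that [j = 0]
    and [j = 1] match the initial values 1 and 0 of [fib_shift]. *)
Lemma label_countK j k :
  2 <= k -> label_count (LabelK k) (k.-1 + j) = fib_shift j.
Proof.
move=> hk; elim/nat_ind2: j => [||j ih ih1].
(* At length [k - 1] only the identity has label (k), through the second clause. *)
- rewrite addn0 label_countE.
  have /andP[iota_in iota312] := iota_class_word k.-1.
  rewrite (@eq_count _ _ (pred1 (iota 1 k.-1))) => [|w /=].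
    rewrite count_uniq_mem ?class_words_uniq // mem_class_words.
    by rewrite perm_refl iota_in.
  rewrite hk addn1 prednK ?(ltnW hk) // eqxx andbT leqNgt ltn_predL.
  rewrite (ltnW hk) /=.
  by have [->|] := eqVneq w (iota 1 k.-1); rewrite ?iota312 ?andbF.
- rewrite addn1 prednK ?(ltnW hk) // label_countE.
  rewrite (@eq_in_count _ _ pred0) ?count_pred0 // => w w_in /=.
  have -> : (k == k + 1) = false by lia.
  rewrite subnn drop0 andbF orbF; apply/negP => /and5P[_ _ _ + _].
  have := class_word_gt0 _ _ w_in; case: w w_in => //= x w _ /andP[]; lia.
rewrite fib_shiftSS -ih -ih1 !addnS !label_countE.
rewrite (@count_class_words _ (word_label (k.-1 + j).+1 (LabelK k))
  (word_label (k.-1 + j) (LabelK k)) false).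
- by rewrite mul0n addn0.
- by move=> w w_in; apply: word_labelK_ext1 (class_word_gt0 _ _ w_in); lia.
- move=> w w_in; have sz := size_class_word _ _ w_in.
  by apply: word_labelK_ext21 (class_word_gt0 _ _ w_in) sz; lia.
- by move=> c hc; rewrite /= word_contains312_block // andbF.
Qed.

Theorem proposition8p15 (n k : nat) (hk : 2 <= k) :
  [/\ label_count Label1a n = Fib (n%:Z - 2)%R,
      ((label_count Label1b n)%:Z = (Fib (n%:Z + 1))%:Z - n%:Z - 1)%R,
      label_count (LabelK k) n = Fib (n%:Z - k%:Z - 1)%R
    & (#|Fishburn_321_3124 n|%:Z = (Fib (n%:Z + 2))%:Z - n%:Z - 1)%R].
Proof.
have FibE (z : int) m : (z + 2)%R = Posz m -> Fib z = fib_shift m.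
  by move=> h; rewrite /Fib h.
split.
- by rewrite label_count1a (FibE _ n) //; lia.
- have := label_count1b n; rewrite (FibE _ n.+3); lia.
- have [hkn|hkn] := leqP k n.+1.
    rewrite (FibE _ (n.+1 - k)); last lia.
    rewrite -(label_countK (n.+1 - k) k hk); congr label_count; lia.
  (* Here [n - k + 1] is negative, so [Fib] takes its [Negz] branch, with value 0. *)
  rewrite label_countK_small // /Fib; case def_z: (_ + 2)%R => [m|//]; lia.
have <- : size (class_words n) = #|Fishburn_321_3124 n|.
  rewrite -count_predT -card_class; apply: eq_card => pi.
  by rewrite inE andbT.
have := size_class_words n; rewrite (FibE _ n.+4); lia.
Qed.
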